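(* Let $\mu_1,\mu_2\in[-\pi,\pi)$, $\kappa_1,\kappa_2\ge 0$, $\kappa_3\in\mathbb{R}$, and let $(\Theta,\Phi)$ have the bivariate von Mises cosine distribution with parameters $\kappa_1,\kappa_2,\kappa_3,\mu_1,\mu_2$. Write $C_c=C_c(\kappa_1,\kappa_2,\kappa_3)$ for the reciprocal of its normalizing constant; all partial derivatives below are evaluated at $(\kappa_1,\kappa_2,\kappa_3)$. Then: 1. The Fisher-Lee circular correlation coefficient between $\Theta$ and $\Phi$ is $$\rho_{\mathrm{FL}}(\Theta,\Phi)=\frac{\left(\frac{1}{C_c}\left\{\frac{\partial C_c}{\partial\kappa_3}-\frac{\partial^2 C_c}{\partial\kappa_1\partial\kappa_2}\right\}\right)\left(\frac{1}{C_c}\frac{\partial^2 C_c}{\partial\kappa_1\partial\kappa_2}\right)}{\sqrt{\left(\frac{1}{C_c}\frac{\partial^2 C_c}{\partial\kappa_1^2}\right)\left(1-\frac{1}{C_c}\frac{\partial^2 C_c}{\partial\kappa_1^2}\right)\left(\frac{1}{C_c}\frac{\partial^2 C_c}{\partial\kappa_2^2}\right)\left(1-\frac{1}{C_c}\frac{\partial^2 C_c}{\partial\kappa_2^2}\right)}}.$$ 2. The Jammalamadaka-Sarma circular correlation coefficient between $\Theta$ and $\Phi$ is $$\rho_{\mathrm{JS}}(\Theta,\Phi)=\frac{\frac{1}{C_c}\left\{\frac{\partial C_c}{\partial\kappa_3}-\frac{\partial^2 C_c}{\partial\kappa_1\partial\kappa_2}\right\}}{\sqrt{\left(1-\frac{1}{C_c}\frac{\partial^2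 C_c}{\partial\kappa_1^2}\right)\left(1-\frac{1}{C_c}\frac{\partial^2 C_c}{\partial\kappa_2^2}\right)}}.$$ 3. The circular variances of $\Theta$ and $\Phi$ are $$\operatorname{var}(\Theta)=1-\frac{1}{C_c}\frac{\partial C_c}{\partial\kappa_1},\qquad \operatorname{var}(\Phi)=1-\frac{1}{C_c}\frac{\partial C_c}{\partial\kappa_2}.$$
   Context: The bivariate von Mises cosine distribution with parameters $\kappa_1,\kappa_2\ge0$, $\kappa_3\in\mathbb{R}$, $\mu_1,\mu_2\in[-\pi,\pi)$ is the distribution on $[-\pi,\pi)^2$ with density $$f(\theta,\phi)=C_c(\kappa_1,\kappa_2,\kappa_3)^{-1}\exp[\kappa_1\cos(\theta-\mu_1)+\kappa_2\cos(\phi-\mu_2)+\kappa_3\cos(\theta-\mu_1-\phi+\mu_2)],$$ where $$C_c(\kappa_1,\kappa_2,\kappa_3)=\int_{-\pi}^{\pi}\int_{-\pi}^{\pi}\exp(\kappa_1\cos\theta+\kappa_2\cos\phi+\kappa_3\cos(\theta-\phi))\,d\theta\,d\phi=4\pi^2\left\{I_0(\kappa_1)I_0(\kappa_2)I_0(\kappa_3)+2\sum_{m=1}^\infty I_m(\kappa_1)I_m(\kappa_2)I_m(\kappa_3)\right\}.$$ Here $I_m$ is the modified Bessel function of the first kind of order $m$. $C_c$ is a smooth function on $\mathbb{R}^3$, and this gives meaning to its partial derivatives also at $\kappa_1=0$ or $\kappa_2=0$. Fisher-Lee coefficient: with $(\Theta_1,\Phi_1),(\Theta_2,\Phi_2)$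 i.i.d. copies of $(\Theta,\Phi)$, $$\rho_{\mathrm{FL}}(\Theta,\Phi)=\frac{E[\sin(\Theta_1-\Theta_2)\sin(\Phi_1-\Phi_2)]}{\sqrt{E[\sin^2(\Theta_1-\Theta_2)]\,E[\sin^2(\Phi_1-\Phi_2)]}}.$$ Jammalamadaka-Sarma coefficient: $$\rho_{\mathrm{JS}}(\Theta,\Phi)=\frac{E[\sin(\Theta-\mu_1)\sin(\Phi-\mu_2)]}{\sqrt{E[\sin^2(\Theta-\mu_1)]\,E[\sin^2(\Phi-\mu_2)]}},$$ where the location parameters $\mu_1,\mu_2$ of the model serve as the circular means of $\Theta,\Phi$. Circular variance: $\operatorname{var}(\Theta)=1-E[\cos(\Theta-\mu_1)]$ and $\operatorname{var}(\Phi)=1-E[\cos(\Phi-\mu_2)]$. *)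

(* Defs.v *)
From HB Require Import structures.
From mathcomp Require Import all_boot all_order all_algebra.
From mathcomp Require Import all_classical all_reals all_analysis.
From mathcomp Require Import measurable_realfun.
Import Order.TTheory GRing.Theory Num.Theory.
Import numFieldNormedType.Exports.

Set Implicit Arguments.
Unset Strict Implicit.
Unset Printing Implicit Defensive.

Local Open Scope classical_set_scope.
Local Open Scope ring_scope.

Section von_mises_cosine.
Variable R : realType.
Local Notation mu := (@lebesgue_measure R).

Definition vmc_const (k1 k2 k3 : R) : R :=
  \int[mu]_(phi in `[- pi, pi]) \int[mu]_(theta in `[- pi, pi])
     expR (k1 * cos theta + k2 * cos phi + k3 * cos (theta - phi)).

Definition vmc_density (k1 k2 k3 mu1 mu2 theta phi : R) : R :=
  (vmc_const k1 k2 k3)^-1 *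
  expR (k1 * cos (theta - mu1) + k2 * cos (phi - mu2)
        + k3 * cos (theta - mu1 - phi + mu2)).

(* [derive1] is total; [pderiv12] differentiates in the second variable
   first. *)
Definition pderiv1 (C : R -> R -> R -> R) (x y z : R) : R :=
  derive1 (fun s => C s y z) x.
Definition pderiv2 (C : R -> R -> R -> R) (x y z : R) : R :=
  derive1 (fun s => C x s z) y.
Definition pderiv3 (C : R -> R -> R -> R) (x y z : R) : R :=
  derive1 (fun s => C x y s) z.
Definition pderiv11 (C : R -> R -> R -> R) : R -> R -> R -> R :=
  pderiv1 (pderiv1 C).
Definition pderiv22 (C : R -> R -> R -> R) : R -> R -> R -> R :=
  pderiv2 (pderiv2 C).
Definition pderiv12 (C : R -> R -> R -> R) : R -> R -> R -> R :=
  pderiv1 (pderiv2 C).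

End von_mises_cosine.

Section random_pairs.
Context (d : measure_display) (T : measurableType d) (R : realType)
  (P : probability T R).
Implicit Types X Y : {RV P >-> R}.

Definition joint_law X Y (A : set (measurableTypeR R * measurableTypeR R)) :
  \bar R := P [set t | A (X t, Y t)].

(* The density lives on [-pi, pi)^2: the integral is restricted to the part
   of A in that square, and (X, Y) lies in it almost surely. *)
Definition has_vmc_law (k1 k2 k3 mu1 mu2 : R) X Y : Prop :=
  forall A : set (measurableTypeR R * measurableTypeR R), measurable A ->
    joint_law X Y A =
    (\int[lebesgue_measure \x lebesgue_measure]_(x in
        A `&` (`[(- pi)%R, pi[ `*` `[(- pi)%R, pi[))
      (vmc_density k1 k2 k3 mu1 mu2 x.1 x.2)%:E)%E.

(* Independence of the random vectors (X1, Y1) and (X2, Y2); nothing is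
   required of X1 and Y1 with respect to each other. *)
Definition independent_pairs X1 Y1 X2 Y2 : Prop :=
  forall A B : set (measurableTypeR R * measurableTypeR R),
    measurable A -> measurable B ->
    P [set t | A (X1 t, Y1 t) /\ B (X2 t, Y2 t)] =
    (joint_law X1 Y1 A * joint_law X2 Y2 B)%E.

Definition mean (f : T -> R) : R := fine ('E_P[f])%E.

(* To be applied to i.i.d. copies (X1, Y1), (X2, Y2) of the pair of angles. *)
Definition fisher_lee X1 Y1 X2 Y2 : R :=
  mean (fun t => sin (X1 t - X2 t) * sin (Y1 t - Y2 t)) /
  Num.sqrt (mean (fun t => sin (X1 t - X2 t) ^+ 2) *
            mean (fun t => sin (Y1 t - Y2 t) ^+ 2)).

Definition jammalamadaka_sarma (mu1 mu2 : R) X Y : R :=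
  mean (fun t => sin (X t - mu1) * sin (Y t - mu2)) /
  Num.sqrt (mean (fun t => sin (X t - mu1) ^+ 2) *
            mean (fun t => sin (Y t - mu2) ^+ 2)).

Definition circular_variance (m : R) X : R :=
  1 - mean (fun t => cos (X t - m)).

End random_pairs.

(* The copies may live on another probability space than the original pair. *)
Definition iid_copies (R : realType)
    (d : measure_display) (T : measurableType d) (P : probability T R)
    (X Y : {RV P >-> R})
    (d' : measure_display) (T' : measurableType d') (P' : probability T' R)
    (X1 Y1 X2 Y2 : {RV P' >-> R}) : Prop :=
  [/\ forall A : set (measurableTypeR R * measurableTypeR R),
        measurable A -> joint_law X1 Y1 A = joint_law X Y A,
      forall A : set (measurableTypeR R * measurableTypeR R),
        measurable A -> joint_law X2 Y2 A = joint_law X Y A &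
      independent_pairs X1 Y1 X2 Y2].

(* Main.v *)
Require Import Defs.
From HB Require Import structures.
From mathcomp Require Import all_boot all_order all_algebra.
From mathcomp Require Import all_classical all_reals all_analysis.
From mathcomp Require Import measurable_realfun.
From mathcomp Require Import ring lra.
Import Order.TTheory GRing.Theory Num.Theory.
Import numFieldNormedType.Exports.
Set Implicit Arguments.
Unset Strict Implicit.
Unset Printing Implicit Defensive.

Local Open Scope classical_set_scope.
Local Open Scope ring_scope.

(* Differentiating under the integral sign, each factor [cos theta], [cos phi],
   [cos (theta - phi)] of an integrand amounts to a derivative of C_c in k1, k2,
   k3. By periodicity the angles can be translated by (mu1, mu2), so the moments
   of (Theta - mu1, Phi - mu2) are derivatives of C_c divided by C_c, with
   E[sin sin] = E[cos (theta - phi)] - E[cos cos]. For two independent copies,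
   expand sin (Theta1 - Theta2) and sin (Phi1 - Phi2) around the locations: the
   mixed moments E[sin cos] vanish since the weight is invariant under
   (theta, phi) |-> (- theta, - phi), which leaves
   2 E[sin sin] E[cos cos] in the numerator and the factors
   2 E[sin^2] E[cos^2] in the denominator. *)

(** * Integration against a measure given by a density *)

Section density.
Local Open Scope ereal_scope.
Context d (T : measurableType d) (R : realType).
Variables (m nu : {measure set T -> \bar R}) (D : set T) (p : T -> R).
Hypotheses (mD : measurable D) (mp : measurable_fun setT p).
Hypothesis p_ge0 : forall x, (0 <= p x)%R.
Hypothesis nuE : forall A, measurable A -> nu A = \int[m]_(x in A `&` D) (p x)%:E.

Import HBNNSimple.

(** Both integrals split over the fibres of the simple function [f]; on each fibre [nuE] is the
    claim up to the factor [r]. *)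
Let nnsfun_integral_density (f : {nnsfun T >-> R}) :
  \int[nu]_x (f x)%:E = \int[m]_(x in D) (f x * p x)%:E.
Proof.
have mpD : measurable_fun D (fun x => (p x)%:E).
  exact/measurable_EFinP/measurable_funTS.
under eq_integral do rewrite fimfunE -fsumEFin//.
rewrite ge0_integral_fsum//; last 2 first.
- by move=> r; exact/measurable_EFinP/measurableT_comp.
- by move=> r x _; rewrite EFinM nnfun_muleindic_ge0.
under [RHS]eq_integral.
  move=> x _; rewrite EFinM fimfunE -fsumEFin// muleC ge0_mule_fsumr; last first.
    by move=> r; exact: (nnfun_muleindic_ge0 f r x).
  over.
rewrite ge0_integral_fsum//; last 2 first.
- move=> r; apply: emeasurable_funM => //.
  by apply/measurable_EFinP/measurable_funTS; exact: measurableT_comp.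
- move=> r x _; apply: mule_ge0; first by rewrite lee_fin.
  exact: (nnfun_muleindic_ge0 f r x).
apply: eq_fsbigr => r _.
have mfr : measurable (f @^-1` [set r]) by [].
rewrite integralZl_indic_nnsfun// integral_indic// setIT nuE// setIC.
under [RHS]eq_integral do rewrite EFinM muleCA.
have [r0|r0] := leP 0%R r.
  rewrite ge0_integralZl//; last 2 first.
  - apply: emeasurable_funM => //; apply/measurable_EFinP/measurable_funTS.
    exact: measurable_indic.
  - by move=> x _; rewrite mule_ge0 ?lee_fin.
  congr (_ * _); rewrite integral_mkcondr; apply: eq_integral => x _.
  by rewrite epatch_indic.
(* A negative [r] is not a value of the nonnegative [f], so its fibre is empty and both terms
   vanish. *)
have -> : f @^-1` [set r] = set0.
  by rewrite preimage_nnfun0.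
rewrite setI0 integral_set0 mule0 integral0_eq// => x _.
by rewrite indic0 mule0 mule0.
Qed.

(** By monotone convergence both sides are limits of their values at the increasing simple
    approximations of [h]; [p_ge0] keeps the products with [p] increasing. *)
Lemma ge0_integral_density (h : T -> \bar R) :
  measurable_fun setT h -> (forall x, 0 <= h x) ->
  \int[nu]_x h x = \int[m]_(x in D) (h x * (p x)%:E).
Proof.
move=> mh h0; pose h_ := nnsfun_approx measurableT mh.
have h_cvg x : (h_ n x)%:E @[n --> \oo] --> h x by exact: cvg_nnsfun_approx.
have mpD : measurable_fun D p by exact: measurable_funTS.
transitivity (lim (\int[nu]_x (h_ n x)%:E @[n --> \oo])).
  rewrite -monotone_convergence//=.
  - by apply: eq_integral => x _; apply/esym/cvg_lim.
  - by move=> n; exact/measurable_EFinP/measurable_funTS.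
  - by move=> n ? _; rewrite lee_fin.
  - by move=> ? _ ? ? mn; rewrite lee_fin; exact/lefP/nd_nnsfun_approx.
transitivity (lim (\int[m]_(x in D) (h_ n x * p x)%:E @[n --> \oo])).
  by apply: congr_lim; apply/funext => n /=.
rewrite -monotone_convergence//=.
- apply: eq_integral => x _; apply/cvg_lim => //.
  under eq_fun do rewrite EFinM.
  by apply: cvgeZr.
- move=> n; apply/measurable_EFinP/measurable_funM => //.
  exact: measurable_funTS.
- by move=> n x _; rewrite lee_fin mulr_ge0.
- move=> x _ a b ab; rewrite lee_fin ler_wpM2r//.
  exact/lefP/nd_nnsfun_approx.
Qed.

(** Multiplication by the nonnegative [p] commutes with taking positive and negative parts, which
    reduces the claim to the nonnegative case. *)
Lemma integral_density (h : T -> R) : measurable_fun setT h ->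
  \int[nu]_x (h x)%:E = \int[m]_(x in D) (h x * p x)%:E.
Proof.
move=> mh; have mhE : measurable_fun setT (EFin \o h) by exact/measurable_EFinP.
rewrite integralE [RHS]integralE !ge0_integral_density//; last 2 first.
- exact: measurable_funeneg.
- exact: measurable_funepos.
congr (_ - _); apply: eq_integral => x _.
- by rewrite !funeposE maxe_pMl ?mul0e ?lee_fin.
- by rewrite !funenegE maxe_pMl ?mul0e ?lee_fin// mulNe.
Qed.

End density.

(** * Bounded measurable functions *)

Section bounded_measurable.
Context d (T : measurableType d) (R : realType).
Implicit Types f g : T -> R.

(** A class stable under sums and products whose members are integrable on measurable sets of finite
    measure; this settles the integrability conditions below. *)
Definition bounded_measurable f :=
  measurable_fun setT f /\ exists M, forall x, `|f x| <= M.

Lemma bounded_measurable_cst (c : R) : bounded_measurable (fun=> c).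
Proof. by split; [exact: measurable_cst|exists `|c|]. Qed.

Lemma bounded_measurableD f g : bounded_measurable f -> bounded_measurable g ->
  bounded_measurable (fun x => f x + g x).
Proof.
move=> [mf [M fM]] [mg [N gN]]; split; first exact: measurable_funD.
by exists (M + N) => x; rewrite (le_trans (ler_normD _ _))// lerD.
Qed.

Lemma bounded_measurableM f g : bounded_measurable f -> bounded_measurable g ->
  bounded_measurable (fun x => f x * g x).
Proof.
move=> [mf [M fM]] [mg [N gN]]; split; first exact: measurable_funM.
by exists (M * N) => x; rewrite normrM ler_pM.
Qed.

Lemma bounded_measurable_integrable (m : {measure set T -> \bar R}) D f :
  measurable D -> (m D < +oo)%E -> bounded_measurable f ->
  m.-integrable D (EFin \o f).
Proof.
move=> mD Doo [mf [M fM]]; apply: measurable_bounded_integrable => //.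
  exact: measurable_funTS.
exists M; split; first exact: num_real.
by move=> N MN x _ /=; rewrite (le_trans (fM x))// ltW.
Qed.

End bounded_measurable.

(** * Linearity of the mean *)

Section mean.
Context d (T : measurableType d) (R : realType) (P : probability T R).
Implicit Types f g : T -> R.

Lemma meanE f : mean P f = \int[P]_x f x.
Proof. by rewrite /mean unlock. Qed.

Lemma mean_cst c : mean P (fun=> c) = c.
Proof. by rewrite /mean expectation_cst. Qed.

Let integrable_bm f : bounded_measurable f -> P.-integrable setT (EFin \o f).
Proof.
move=> bf; apply: bounded_measurable_integrable => //.
by rewrite ltey_eq fin_num_measure.
Qed.

Lemma meanD f g : bounded_measurable f -> bounded_measurable g ->
  mean P (fun x => f x + g x) = mean P f + mean P g.
Proof. by move=> ? ?; rewrite !meanE RintegralD//; exact: integrable_bm. Qed.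

Lemma meanB f g : bounded_measurable f -> bounded_measurable g ->
  mean P (fun x => f x - g x) = mean P f - mean P g.
Proof. by move=> ? ?; rewrite !meanE RintegralB//; exact: integrable_bm. Qed.

End mean.

(** * Product formula for independent random vectors *)

Section independence.
Context d d' (T : measurableType d) (S : measurableType d') (R : realType).
Variables (P : probability T R) (U V : T -> S).
Hypotheses (mU : measurable_fun setT U) (mV : measurable_fun setT V).
Hypothesis indepUV : forall A B, measurable A -> measurable B ->
  P [set t | A (U t) /\ B (V t)] = (P (U @^-1` A) * P (V @^-1` B))%E.

(** By independence the law of [(U, V)] agrees with the product of the marginal laws on rectangles,
    hence everywhere; Fubini then factors the integral. *)
Lemma mean_indep (f g : S -> R) :
  bounded_measurable f -> bounded_measurable g ->
  mean P (fun t => f (U t) * g (V t)) =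
  mean P (fun t => f (U t)) * mean P (fun t => g (V t)).
Proof.
move=> bf bg; have [[mf _] [mg _]] := (bf, bg).
pose U' : {mfun T >-> S} := HB.pack U (isMeasurableFun.Build _ _ _ _ _ mU).
pose V' : {mfun T >-> S} := HB.pack V (isMeasurableFun.Build _ _ _ _ _ mV).
pose W t := (U t, V t).
have mW : measurable_fun setT W by exact: measurable_fun_pair.
pose W' : {mfun T >-> (S * S)%type} :=
  HB.pack W (isMeasurableFun.Build _ _ _ _ _ mW).
pose F z := f z.1 * g z.2.
have mF : measurable_fun setT F.
  by apply: measurable_funM; exact: measurableT_comp.
have bm_comp d1 (T1 : measurableType d1) (phi : T1 -> S) h :
    measurable_fun setT phi -> bounded_measurable h ->
    bounded_measurable (h \o phi).
  move=> mphi [mh [M hM]]; split; first exact: measurableT_comp.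
  by exists M => x; exact: hM.
have bF : bounded_measurable F.
  by apply: bounded_measurableM; exact: bm_comp.
have intP h : bounded_measurable h -> P.-integrable setT (EFin \o h).
  move=> bh; apply: bounded_measurable_integrable => //.
  by rewrite ltey_eq fin_num_measure.
have intD h (Z : {mfun T >-> S}) : bounded_measurable h ->
    (distribution P Z).-integrable setT (EFin \o h).
  move=> bh; apply: bounded_measurable_integrable => //.
  by rewrite ltey_eq fin_num_measure.
have distE h (Z : {mfun T >-> S}) : bounded_measurable h ->
    (\int[P]_t (h (Z t))%:E = \int[distribution P Z]_x (h x)%:E)%E.
  move=> bh; rewrite integral_pushforward//.
  - by apply/measurable_EFinP; case: bh.
  - by apply: intP; exact: bm_comp.
rewrite !meanE /Rintegral.
have -> : (\int[P]_t (f (U t) * g (V t))%:E =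
    \int[distribution P U' \x distribution P V']_z (F z)%:E)%E.
  transitivity (\int[distribution P W']_z (F z)%:E)%E; last first.
    apply: eq_measure_integral => A mA _; apply/esym.
    exact: product_measure_unique.
  rewrite integral_pushforward//; first exact/measurable_EFinP.
  by apply: intP; apply: bounded_measurableM; exact: bm_comp.
(* Fubini asks for integrability, which follows from the finite total mass of the product law. *)
rewrite -integral12_prod_meas1; last first.
  apply: bounded_measurable_integrable => //.
  have := product_measure1E (distribution P U') (distribution P V')
    (@measurableT _ S) (@measurableT _ S).
  rewrite setXTT => UVT.
  have : ((distribution P U' \x distribution P V') [set: S * S] < +oo)%E.
    rewrite UVT lte_mul_pinfty//; first exact: fin_num_measure.
    by rewrite ltey_eq; apply/orP; left; exact: fin_num_measure.
  exact.
rewrite (distE f U')// (distE g V')// /fubini_F /F/=.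
under eq_integral => x _.
  under eq_integral do rewrite EFinM.
  rewrite integralZl//; last exact: intD.
  over.
have fin h (Z : {mfun T >-> S}) : bounded_measurable h ->
    (\int[distribution P Z]_x (h x)%:E \is a fin_num)%E.
  by move=> bh; apply: integrable_fin_num => //; exact: intD.
rewrite -(fineK (fin g V' bg)) integralZr//; last exact: intD.
by rewrite fineM// fin.
Qed.

End independence.

(** * Integrals of continuous periodic functions over one period *)

Section circle.
Variable R : realType.
Local Notation mu := (@lebesgue_measure R).
Implicit Types (g : R -> R) (a b m : R).

Lemma continuous_integrable_itv g a b : continuous g ->
  mu.-integrable `[a, b] (EFin \o g).
Proof.
move=> cg; apply: continuous_compact_integrable; first exact: segment_compact.
exact: continuous_subspaceT.
Qed.

Lemma Rintegral_shift g a b m : a <= b -> continuous g ->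
  \int[mu]_(x in `[a, b]) g (x - m) = \int[mu]_(x in `[a - m, b - m]) g x.
Proof.
move=> ab cg; have d1 : (fun x => x - m)^`()%classic = cst 1.
  by apply/funext => x; rewrite derive1E deriveB// derive_id derive_cst subr0.
rewrite /Rintegral; congr fine; apply/esym.
rewrite (@integration_by_substitution_increasing _ (fun x => x - m))//.
- by apply: eq_integral => x _; rewrite !fctE d1 mulr1.
- by move=> x y _ _; rewrite ltrD2r.
- by rewrite d1 => x _; exact: cvg_cst.
- by rewrite d1; exact: is_cvg_cst.
- by rewrite d1; exact: is_cvg_cst.
- split => //.
  + by apply: cvg_at_right_filter; apply: cvgB => //; exact: cvg_cst.
  + by apply: cvg_at_left_filter; apply: cvgB => //; exact: cvg_cst.
- exact: continuous_subspaceT.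
Qed.

Lemma Rintegral_opp g : continuous g ->
  \int[mu]_(x in `[- pi, pi]) g (- x) = \int[mu]_(x in `[- pi, pi]) g x.
Proof.
move=> cg; rewrite /Rintegral; congr fine; apply/esym.
have := @integration_by_substitution_oppr R g (- pi) pi.
rewrite opprK; apply; last exact: continuous_subspaceT.
by rewrite ge0_cp// pi_ge0.
Qed.

Lemma Rintegral_split g a b c : a <= b -> b <= c -> continuous g ->
  \int[mu]_(x in `[a, c]) g x =
  \int[mu]_(x in `[a, b]) g x + \int[mu]_(x in `[b, c]) g x.
Proof.
move=> ab bc cg; apply/eqP; rewrite addrC -subr_eq; apply/eqP.
rewrite Rintegral_itvB ?bnd_simp//; last exact: continuous_integrable_itv.
(* The difference is an integral over the interval open at [b]; adding the point [b] does not change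
   it. *)
apply: Rintegral_itv_obnd_cbnd.
apply: integrableS (continuous_integrable_itv b c cg) => //.
exact: subset_itv_oc_cc.
Qed.

(** A translation only moves the window of integration, which remains a full period. The range of
    [m] contains that of the location parameters. *)
Lemma Rintegral_periodic g m : continuous g ->
  (forall x, g (x + pi *+ 2) = g x) -> - pi <= m <= pi ->
  \int[mu]_(x in `[- pi, pi]) g (x - m) = \int[mu]_(x in `[- pi, pi]) g x.
Proof.
move=> cg pg; have pi0 := pi_ge0 R.
(* The window becomes [[- pi - n, pi - n]]; its part left of [- pi] is carried onto [[pi - n, pi]]
   by the period, which restores [[- pi, pi]]. *)
have shift n : 0 <= n <= pi *+ 2 ->
    \int[mu]_(x in `[- pi, pi]) g (x - n) = \int[mu]_(x in `[- pi, pi]) g x.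
  move=> /andP[n0 n2]; rewrite Rintegral_shift//; last by lra.
  rewrite (@Rintegral_split g _ (- pi))//; [|lra|lra].
  rewrite [RHS](@Rintegral_split g _ (pi - n))//; [|lra|lra].
  rewrite addrC; congr +%R.
  transitivity (\int[mu]_(x in `[pi - n, pi]) g (x - pi *+ 2)).
    rewrite Rintegral_shift//; last by lra.
    rewrite (_ : pi - n - pi *+ 2 = - pi - n); last by ring.
    by rewrite (_ : pi - pi *+ 2 = - pi :> R); last by ring.
  by apply: eq_Rintegral => x _; rewrite -pg subrK.
(* A negative [m] is raised by one period into the range already treated. *)
move=> /andP[mN mpi]; have [m0|m0] := leP 0 m; first by apply: shift; lra.
rewrite -(shift (m + pi *+ 2)); last by lra.
by apply: eq_Rintegral => x _; rewrite -[RHS]pg; congr g; ring.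
Qed.

End circle.

(** * Double integrals over the square as iterated integrals *)

Section square.
Variable R : realType.
Local Notation mu := (@lebesgue_measure R).
Local Notation RR := (measurableTypeR R * measurableTypeR R)%type.
Local Notation I := (`[- pi, pi[%classic : set (measurableTypeR R)).
Implicit Types f : R -> R -> R.

(** Half-open, like the domain in [has_vmc_law]; the iterated integrals run over closed intervals,
    as in [vmc_const]. *)
Definition square : set RR := I `*` I.

Definition square_integral f : R := \int[(mu \x mu)%E]_(z in square) f z.1 z.2.

Lemma measurable_square : measurable square.
Proof. by apply: measurableX; exact: measurable_itv. Qed.

Let muI : (mu I < +oo)%E.
Proof.
by rewrite /= lebesgue_measure_itv/=; case: ifPn => // _; rewrite -EFinB ltry.
Qed.

Lemma square_lty : ((mu \x mu) square < +oo)%E.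
Proof.
rewrite [ltLHS](_ : _ = mu I * mu I)%E; last first.
  by apply: product_measure1E; exact: measurable_itv.
by rewrite lte_mul_pinfty// ge0_fin_numE.
Qed.

Let bm_restrict f : bounded_measurable (fun z : RR => f z.1 z.2) ->
  (mu \x mu)%E.-integrable setT
    ((fun z : RR => (f z.1 z.2)%:E) \_ square).
Proof.
move=> bf; apply/(integrable_mkcond _ measurable_square).
exact: bounded_measurable_integrable measurable_square square_lty bf.
Qed.

(** The endpoint [pi] is a null set. *)
Let integral_half_open (h : R -> R) :
  measurable_fun I h ->
  (\int[mu]_x (((EFin \o h) \_ I) x) = \int[mu]_(x in `[(- pi)%R, pi%R]) (h x)%:E)%E.
Proof.
move=> mh; rewrite -integral_mkcond integral_itv_bndo_bndc//.
exact/measurable_EFinP.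
Qed.

Let restrict_squareE f x y : ((fun z : RR => (f z.1 z.2)%:E) \_ square) (x, y) =
  if (x \in I) && (y \in I) then (f x y)%:E else 0%E.
Proof. by rewrite patchE in_setX. Qed.

Let section_integral (h : R -> R) :
  bounded_measurable (h : measurableTypeR R -> R) ->
  (\int[mu]_x (((EFin \o h) \_ I) x) =
   (\int[mu]_(x in `[- pi, pi]) h x)%R%:E)%E.
Proof.
move=> bh; rewrite integral_half_open; last first.
  by apply: measurable_funTS; case: bh.
rewrite /Rintegral fineK//; apply: integrable_fin_num => //.
apply: bounded_measurable_integrable => //.
by rewrite /= lebesgue_measure_itv/=; case: ifPn => // _; rewrite -EFinB ltry.
Qed.

Let outer_integral (G : R -> \bar R) (r : R -> R) :
  measurable_fun setT (G : measurableTypeR R -> _) ->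
  G =1 (EFin \o r) \_ I ->
  fine (\int[mu]_x G x) = \int[mu]_(x in `[- pi, pi]) r x.
Proof.
move=> mG /funext GE; rewrite GE integral_half_open//.
apply/measurable_EFinP; apply/measurable_restrictT; first exact: measurable_itv.
by rewrite -GE.
Qed.

(** Fubini for the extension of [f] by zero: the inner integral vanishes unless the outer variable
    lies in the half-open interval. Both orders of integration are provided because changes of
    variable act on the inner integral. *)
Lemma square_integral21 f : bounded_measurable (fun z : RR => f z.1 z.2) ->
  square_integral f =
  \int[mu]_(y in `[- pi, pi]) \int[mu]_(x in `[- pi, pi]) f x y.
Proof.
move=> bf; rewrite /square_integral {1}/Rintegral integral_mkcond.
have bf' := bm_restrict bf.
rewrite -integral21_prod_meas1//; apply: outer_integral.
  exact: (measurable_fubini_G bf').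
move=> y; rewrite /fubini_G patchE.
under eq_integral do rewrite restrict_squareE.
case: ifPn => yI; last by rewrite integral0_eq// => x _; rewrite andbF.
rewrite /= -section_integral.
  by apply: eq_integral => x _; rewrite andbT patchE.
case: bf => mf [M fM]; split; last by exists M => x; exact: (fM (x, y)).
exact: (measurable_fun_pair1 y mf).
Qed.

Lemma square_integral12 f : bounded_measurable (fun z : RR => f z.1 z.2) ->
  square_integral f =
  \int[mu]_(x in `[- pi, pi]) \int[mu]_(y in `[- pi, pi]) f x y.
Proof.
move=> bf; rewrite /square_integral {1}/Rintegral integral_mkcond.
have bf' := bm_restrict bf.
rewrite -integral12_prod_meas1//; apply: outer_integral.
  exact: (measurable_fubini_F bf').
move=> x; rewrite /fubini_F patchE.
under eq_integral do rewrite restrict_squareE.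
case: ifPn => xI; last by rewrite integral0_eq.
rewrite /= -section_integral.
  by apply: eq_integral => y _; rewrite patchE.
case: bf => mf [M fM]; split; last by exists M => y; exact: (fM (x, y)).
exact: (measurable_fun_pair2 x mf).
Qed.

End square.

(** Here [g], [a] and [b] stand for the values at one point of the square of the prefactor, of the
    coefficient of the parameter and of the rest of the exponent. *)
Lemma is_derive_expR_affine (R : realType) (g a b s : R) :
  is_derive s (1 : R) (fun t => g * expR (t * a + b)) (g * a * expR (s * a + b)).
Proof.
have dl : is_derive s (1 : R) (fun t : R => t * a + b) a.
  have d1 := is_deriveM (is_derive_id s (1 : R)) (is_derive_cst a s (1 : R)).
  have := is_deriveD d1 (is_derive_cst b s (1 : R)).
  by move/is_derive_eq; apply; rewrite scaler0 add0r addr0 /GRing.scale/= mulr1.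
have de := @is_derive1_comp R expR _ s _ _ (is_derive_expR _) dl.
have := is_deriveM (is_derive_cst g s (1 : R)) de.
by move/is_derive_eq; apply; rewrite scaler0 addr0 /GRing.scale/=; ring.
Qed.

(** * Doubly periodic functions and their integrals *)

Section torus_functions.
Variable R : realType.
Local Notation mu := (@lebesgue_measure R).
Local Notation RR := (measurableTypeR R * measurableTypeR R)%type.
Implicit Types f g : R -> R -> R.

(** Boundedness and joint measurability serve Fubini and domination; continuity and period [2 pi] in
    each variable serve the changes of variable in the inner integral. *)
Record torus_function f := TorusFunction {
  torus_bm : bounded_measurable (fun z : RR => f z.1 z.2);
  torus_continuous1 : forall y, continuous (f^~ y);
  torus_continuous2 : forall x, continuous (f x);
  torus_periodic1 : forall x y, f (x + pi *+ 2) y = f x y;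
  torus_periodic2 : forall x y, f x (y + pi *+ 2) = f x y }.

Lemma torus_cst c : torus_function (fun _ _ => c).
Proof.
by split=> //; [exact: bounded_measurable_cst|move=> ? ?; exact: cvg_cst..].
Qed.

Lemma torusD f g : torus_function f -> torus_function g ->
  torus_function (fun x y => f x y + g x y).
Proof.
case=> ? f1 f2 pf1 pf2 [? g1 g2 pg1 pg2]; split.
- exact: (@bounded_measurableD _ RR _ (fun z => f z.1 z.2) (fun z => g z.1 z.2)).
- by move=> y x; apply: cvgD; [exact: f1|exact: g1].
- by move=> x y; apply: cvgD; [exact: f2|exact: g2].
- by move=> x y; rewrite pf1 pg1.
- by move=> x y; rewrite pf2 pg2.
Qed.

Lemma torusM f g : torus_function f -> torus_function g ->
  torus_function (fun x y => f x y * g x y).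
Proof.
case=> ? f1 f2 pf1 pf2 [? g1 g2 pg1 pg2]; split.
- exact: (@bounded_measurableM _ RR _ (fun z => f z.1 z.2) (fun z => g z.1 z.2)).
- by move=> y x; apply: cvgM; [exact: f1|exact: g1].
- by move=> x y; apply: cvgM; [exact: f2|exact: g2].
- by move=> x y; rewrite pf1 pg1.
- by move=> x y; rewrite pf2 pg2.
Qed.

(** Monotonicity and nonnegativity of [h] turn the bound [M] of [f] into the bound [h M]; meant for
    [expR]. *)
Lemma torus_comp (h : R -> R) f :
  continuous h -> {homo h : x y / x <= y} -> (forall x, 0 <= h x) ->
  torus_function f -> torus_function (fun x y => h (f x y)).
Proof.
move=> ch hmono h0 [[mf [M fM]] f1 f2 pf1 pf2]; split.
- split; first exact: (measurableT_comp (continuous_measurable_fun ch) mf).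
  exists (h M) => z; rewrite ger0_norm// hmono// (le_trans (ler_norm _))//.
- by move=> y x; apply: (continuous_comp (f1 y x)); exact: ch.
- by move=> x y; apply: (continuous_comp (f2 x y)); exact: ch.
- by move=> x y; rewrite pf1.
- by move=> x y; rewrite pf2.
Qed.

Lemma torus_fst (h : R -> R) : continuous h -> (forall x, `|h x| <= 1) ->
  (forall x, h (x + pi *+ 2) = h x) -> torus_function (fun x _ => h x).
Proof.
move=> ch h1 ph; split=> //.
- split; last by exists 1 => z; exact: h1.
  apply: (measurableT_comp (continuous_measurable_fun ch)).
  exact: measurable_fst.
- by move=> x y; exact: cvg_cst.
Qed.

Lemma torus_snd (h : R -> R) : continuous h -> (forall x, `|h x| <= 1) ->
  (forall x, h (x + pi *+ 2) = h x) -> torus_function (fun _ y => h y).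
Proof.
move=> ch h1 ph; split=> //.
- split; last by exists 1 => z; exact: h1.
  apply: (measurableT_comp (continuous_measurable_fun ch)).
  exact: measurable_snd.
- by move=> x y; exact: cvg_cst.
Qed.

Lemma torus_expR f : torus_function f -> torus_function (fun x y => expR (f x y)).
Proof.
apply: torus_comp; first exact: continuous_expR.
  by move=> x y; rewrite ler_expR.
by move=> x; exact: expR_ge0.
Qed.

Lemma torus_cos1 : torus_function (fun x _ => cos x).
Proof.
apply: torus_fst; [exact: continuous_cos| |exact: cosD2pi].
by move=> x; rewrite ler_norml cos_geN1 cos_le1.
Qed.

Lemma torus_sin1 : torus_function (fun x _ => sin x).
Proof.
apply: torus_fst; [exact: continuous_sin| |exact: sinD2pi].
by move=> x; rewrite ler_norml sin_geN1 sin_le1.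
Qed.

Lemma torus_cos2 : torus_function (fun _ x => cos x).
Proof.
apply: torus_snd; [exact: continuous_cos| |exact: cosD2pi].
by move=> x; rewrite ler_norml cos_geN1 cos_le1.
Qed.

Lemma torus_sin2 : torus_function (fun _ x => sin x).
Proof.
apply: torus_snd; [exact: continuous_sin| |exact: sinD2pi].
by move=> x; rewrite ler_norml sin_geN1 sin_le1.
Qed.

Lemma torus_cosB : torus_function (fun x y => cos (x - y)).
Proof.
(* The addition formula leaves sums and products of one-variable functions. *)
rewrite (_ : (fun _ => _) = fun x y => cos x * cos y + sin x * sin y).
  exact: torusD (torusM torus_cos1 torus_cos2) (torusM torus_sin1 torus_sin2).
by apply/funext => x; apply/funext => y; rewrite cosB.
Qed.

Lemma torus_shift f a b : torus_function f ->
  torus_function (fun x y => f (x - a) (y - b)).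
Proof.
have mB c : measurable_fun setT ((fun x => x - c) : measurableTypeR R -> R).
  by apply: measurable_funB; [exact: measurable_id|exact: measurable_cst].
have cB c : continuous ((fun x => x - c) : R -> R).
  by move=> x; apply: cvgB; [exact: cvg_id|exact: cvg_cst].
case=> -[mf [M fM]] f1 f2 pf1 pf2; split.
- split; last by exists M => -[x y]; exact: (fM (x - a, y - b)).
  pose s (z : RR) : RR := (z.1 - a, z.2 - b).
  have ms : measurable_fun setT s.
    apply: measurable_fun_pair.
      exact: (measurableT_comp (mB a) measurable_fst).
    exact: (measurableT_comp (mB b) measurable_snd).
  exact: (measurableT_comp mf ms).
- move=> y x.
  exact: (@continuous_comp _ _ _ _ (f^~ (y - b)) x (cB a x) (f1 _ _)).
- move=> x y.
  exact: (@continuous_comp _ _ _ _ (f (x - a)) y (cB b y) (f2 _ _)).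
- by move=> x y; rewrite addrAC pf1.
- by move=> x y; rewrite addrAC pf2.
Qed.

(** One variable is translated at a time, each as the inner variable of the suitable order of
    integration. *)
Lemma square_integral_shift f a b : torus_function f ->
  - pi <= a <= pi -> - pi <= b <= pi ->
  square_integral (fun x y => f (x - a) (y - b)) = square_integral f.
Proof.
move=> tf api bpi; rewrite square_integral21; last first.
  exact: torus_bm (torus_shift a b tf).
(* The zero translation in the first variable yields bounded measurability of the intermediate
   function [f x (y - b)]. *)
have s0 := torus_shift 0 b tf.
transitivity (square_integral (fun x y => f x (y - b))).
  rewrite square_integral21; last first.
    by have := torus_bm s0; under eq_fun do rewrite subr0.
  apply: eq_Rintegral => y _; apply: (@Rintegral_periodic _ (f^~ (y - b))) => //.
  - exact: torus_continuous1.
  - by move=> x; exact: torus_periodic1.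
rewrite !square_integral12; last 2 first.
- exact: torus_bm.
- by have := torus_bm s0; under eq_fun do rewrite subr0.
apply: eq_Rintegral => x _; apply: (@Rintegral_periodic _ (f x)) => //.
- exact: torus_continuous2.
- by move=> y; exact: torus_periodic2.
Qed.

Lemma torus_integrable f : torus_function f ->
  (mu \x mu)%E.-integrable (@square R) (fun z => (f z.1 z.2)%:E).
Proof.
move=> tf; have [mQ Qoo] := (@measurable_square R, @square_lty R).
exact: bounded_measurable_integrable mQ Qoo (torus_bm tf).
Qed.

Lemma square_integralD f g : torus_function f -> torus_function g ->
  square_integral (fun x y => f x y + g x y) =
  square_integral f + square_integral g.
Proof.
move=> tf tg; apply: RintegralD; first exact: measurable_square.
- exact: torus_integrable tf.
- exact: torus_integrable tg.
Qed.

Lemma square_integralZ c f : torus_function f ->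
  square_integral (fun x y => c * f x y) = c * square_integral f.
Proof.
move=> tf; apply: RintegralZl; first exact: measurable_square.
exact: torus_integrable tf.
Qed.

(** Reflecting [x] and then [y], each in the inner integral, turns the integral into its own
    opposite. *)
Lemma square_integral_odd f : torus_function f ->
  (forall x y, f (- x) (- y) = - f x y) -> square_integral f = 0.
Proof.
move=> tf fN; case: (tf) => bmf f1 f2 _ _; case: (bmf) => mf [M fM].
have bmN : bounded_measurable (fun z : RR => f (- z.1) z.2).
  split; last by exists M => -[x y]; exact: (fM (- x, y)).
  pose s (z : RR) : RR := (- z.1, z.2).
  have ms : measurable_fun setT s.
    apply: measurable_fun_pair; last exact: measurable_snd.
    apply: measurable_funN; exact: measurable_fst.
  exact: (measurableT_comp mf ms).
have : square_integral f = - square_integral f.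
  rewrite -mulN1r -square_integralZ//.
  transitivity (square_integral (fun x y => f (- x) y)).
    rewrite !square_integral21//; apply: eq_Rintegral => y _.
    exact/esym/(Rintegral_opp (f1 y)).
  have := torusM (torus_cst (-1)) tf => -[bmNf _ _ _ _].
  rewrite !square_integral12//; apply: eq_Rintegral => x _.
  rewrite -(Rintegral_opp (f2 (- x))).
  by apply: eq_Rintegral => y _; rewrite fN mulN1r.
lra.
Qed.

(* The derivative in [s] of the integrand is dominated on [s0 - 1, s0 + 1] by
   the constant [|g| |a| exp ((|s0| + 1) |a| + |b|)]. *)
Lemma derive1_square_integral_expR g a b (s0 : R) :
  torus_function g -> torus_function a -> torus_function b ->
  derive1 (fun s =>
    square_integral (fun x y => g x y * expR (s * a x y + b x y))) s0 =
  square_integral (fun x y => g x y * a x y * expR (s0 * a x y + b x y)).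
Proof.
move=> tg ta tb.
have [_ [Mg gM]] := torus_bm tg; have [_ [Ma aM]] := torus_bm ta.
have [_ [Mb bM]] := torus_bm tb.
have tF s : torus_function (fun x y => g x y * expR (s * a x y + b x y)).
  by apply: torusM => //; apply/torus_expR/torusD => //; apply: torusM => //;
    exact: torus_cst.
pose F s (z : RR) := g z.1 z.2 * expR (s * a z.1 z.2 + b z.1 z.2).
have d1F (s : R) (z : RR) : derive1 (F ^~ z) s =
    g z.1 z.2 * a z.1 z.2 * expR (s * a z.1 z.2 + b z.1 z.2).
  rewrite derive1E.
  by have /@derive_val := is_derive_expR_affine (g z.1 z.2) (a z.1 z.2)
    (b z.1 z.2) s.
have MF s : s \in `]s0 - 1, s0 + 1[ -> `|s| <= `|s0| + 1.
  rewrite in_itv/= ler_norml => /andP[? ?]; have := ler_norm s0.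
  by have := ler_norm (- s0); rewrite normrN; lra.
rewrite (@differentiation_under_integral R _ RR (mu \x mu)%E F (@square R)
  (@measurable_square R) s0 (s0 - 1) (s0 + 1) _ _ _
  (fun=> Mg * Ma * expR ((`|s0| + 1) * Ma + Mb))).
- by apply: eq_Rintegral => z _; exact: d1F.
- by rewrite /= in_itv/=; lra.
- by move=> s _; exact: torus_integrable (tF s).
- move=> s z _ _.
  by have [] := is_derive_expR_affine (g z.1 z.2) (a z.1 z.2) (b z.1 z.2) s.
- move=> z; have Mg0 := le_trans (normr_ge0 _) (gM z).
  by rewrite !mulr_ge0 ?expR_ge0// (le_trans (normr_ge0 _) (aM z)).
- apply: bounded_measurable_integrable (@measurable_square R) (@square_lty R) _.
  exact: bounded_measurable_cst.
- move=> s z sI _; rewrite /partial1of2 d1F !normrM !ler_pM//.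
  rewrite ger0_norm ?expR_ge0// ler_expR.
  rewrite (le_trans (ler_norm _))// (le_trans (ler_normD _ _))// lerD//.
  by rewrite normrM ler_pM// MF.
Qed.

End torus_functions.

(** * Moments of the weight and derivatives of the normalizing constant *)

Section von_mises.
Variable R : realType.
Local Notation RR := (measurableTypeR R * measurableTypeR R)%type.
Implicit Types (f g s c : R -> R -> R) (k : R).

(** Unnormalised moment for locations 0, kept as a function of the concentrations: the family is
    stable under the partial derivatives, each of which multiplies [f] by a cosine. *)
Definition vmc_moment f k1 k2 k3 : R := square_integral (fun x y =>
  f x y * expR (k1 * cos x + k2 * cos y + k3 * cos (x - y))).

Lemma torus_vmc_weight k1 k2 k3 : torus_function (fun x y : R =>
  expR (k1 * cos x + k2 * cos y + k3 * cos (x - y))).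
Proof.
apply: torus_expR; apply: torusD; first apply: torusD; apply: torusM;
  try exact: torus_cst.
- exact: torus_cos1.
- exact: torus_cos2.
- exact: torus_cosB.
Qed.

Lemma vmc_constE : @vmc_const R = vmc_moment (fun _ _ => 1).
Proof.
apply/funext => k1; apply/funext => k2; apply/funext => k3.
rewrite /vmc_moment square_integral21; last first.
  exact: torus_bm (torusM (torus_cst 1) (torus_vmc_weight k1 k2 k3)).
by apply: eq_Rintegral => y _; apply: eq_Rintegral => x _; rewrite mul1r.
Qed.

(** Makes the density nonnegative, as integration against it requires. *)
Lemma vmc_const_ge0 k1 k2 k3 : 0 <= vmc_const k1 k2 k3.
Proof.
by apply: Rintegral_ge0 => y _; apply: Rintegral_ge0 => x _; exact: expR_ge0.
Qed.

(** The exponent is affine in [k1] with slope [cos x], and [b] is the rest of it. Equality as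
    functions of all three parameters allows iteration for second derivatives. *)
Lemma pderiv1_vmc_moment f : torus_function f ->
  pderiv1 (vmc_moment f) = vmc_moment (fun x y => f x y * cos x).
Proof.
move=> tf; apply/funext => k1; apply/funext => k2; apply/funext => k3.
pose b x y := k2 * cos y + k3 * cos (x - y) : R.
have tb : torus_function b.
  by apply: torusD; apply: torusM; [exact: torus_cst|exact: torus_cos2|
    exact: torus_cst|exact: torus_cosB].
have -> : vmc_moment (fun x y => f x y * cos x) k1 k2 k3 =
    square_integral (fun x y => f x y * cos x * expR (k1 * cos x + b x y)).
  by apply: eq_Rintegral => z _; rewrite /b addrA.
rewrite -(derive1_square_integral_expR k1 tf (torus_cos1 R) tb).
congr (derive1 _ k1); apply/funext => u.
by apply: eq_Rintegral => z _; rewrite /b addrA.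
Qed.

Lemma pderiv2_vmc_moment f : torus_function f ->
  pderiv2 (vmc_moment f) = vmc_moment (fun x y => f x y * cos y).
Proof.
move=> tf; apply/funext => k1; apply/funext => k2; apply/funext => k3.
pose b x y := k1 * cos x + k3 * cos (x - y) : R.
have tb : torus_function b.
  by apply: torusD; apply: torusM; [exact: torus_cst|exact: torus_cos1|
    exact: torus_cst|exact: torus_cosB].
have -> : vmc_moment (fun x y => f x y * cos y) k1 k2 k3 =
    square_integral (fun x y => f x y * cos y * expR (k2 * cos y + b x y)).
  by apply: eq_Rintegral => z _; rewrite /b addrCA addrA.
rewrite -(derive1_square_integral_expR k2 tf (torus_cos2 R) tb).
congr (derive1 _ k2); apply/funext => u.
by apply: eq_Rintegral => z _; rewrite /b addrCA addrA.
Qed.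

Lemma pderiv3_vmc_moment f : torus_function f ->
  pderiv3 (vmc_moment f) = vmc_moment (fun x y => f x y * cos (x - y)).
Proof.
move=> tf; apply/funext => k1; apply/funext => k2; apply/funext => k3.
pose b x y := k1 * cos x + k2 * cos y : R.
have tb : torus_function b.
  by apply: torusD; apply: torusM; [exact: torus_cst|exact: torus_cos1|
    exact: torus_cst|exact: torus_cos2].
have -> : vmc_moment (fun x y => f x y * cos (x - y)) k1 k2 k3 =
    square_integral (fun x y => f x y * cos (x - y) *
      expR (k3 * cos (x - y) + b x y)).
  by apply: eq_Rintegral => z _; congr (_ * expR _); rewrite /b; ring.
rewrite -(derive1_square_integral_expR k3 tf (torus_cosB R) tb).
congr (derive1 _ k3); apply/funext => u.
by apply: eq_Rintegral => z _; congr (_ * expR _); rewrite /b; ring.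
Qed.

Lemma eq_vmc_moment f g k1 k2 k3 : f =2 g ->
  vmc_moment f k1 k2 k3 = vmc_moment g k1 k2 k3.
Proof. by move=> fg; apply: eq_Rintegral => z _; rewrite fg. Qed.

Lemma vmc_momentD f g k1 k2 k3 : torus_function f -> torus_function g ->
  vmc_moment (fun x y => f x y + g x y) k1 k2 k3 =
  vmc_moment f k1 k2 k3 + vmc_moment g k1 k2 k3.
Proof.
move=> tf tg; have tw := torus_vmc_weight k1 k2 k3.
rewrite /vmc_moment -square_integralD; [|exact: torusM..].
by apply: eq_Rintegral => z _; rewrite mulrDl.
Qed.

Lemma vmc_moment_odd f k1 k2 k3 : torus_function f ->
  (forall x y, f (- x) (- y) = - f x y) -> vmc_moment f k1 k2 k3 = 0.
Proof.
move=> tf fN; apply: square_integral_odd.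
  exact: torusM tf (torus_vmc_weight k1 k2 k3).
(* All three cosines of the weight are invariant under the joint sign change. *)
by move=> x y; rewrite fN !cosN -opprD cosN mulNr.
Qed.

(** * Means of functions of the centred angles *)

Section moments.
Context d (T : measurableType d) (P : probability T R).
Variables (mu1 mu2 k1 k2 k3 : R) (X Y : {RV P >-> R}).
Hypotheses (mu1pi : - pi <= mu1 <= pi) (mu2pi : - pi <= mu2 <= pi).

Let mXY : measurable_fun setT ((fun t => (X t, Y t)) : T -> RR).
Proof.
exact: measurable_fun_pair (measurable_funPT X) (measurable_funPT Y).
Qed.

Lemma bounded_measurable_centred f : torus_function f ->
  bounded_measurable (fun t => f (X t - mu1) (Y t - mu2)).
Proof.
move=> tf; have [mf [M fM]] := torus_bm (torus_shift mu1 mu2 tf).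
split; last by exists M => t; exact: (fM (X t, Y t)).
exact: (measurableT_comp mf mXY).
Qed.

(** The mean is an integral against the law of [(X, Y)], hence against the density on the square;
    translating by [(mu1, mu2)] over full periods leaves the centred weight. *)
Lemma mean_vmc f : has_vmc_law k1 k2 k3 mu1 mu2 X Y -> torus_function f ->
  mean P (fun t => f (X t - mu1) (Y t - mu2)) =
  1 / vmc_const k1 k2 k3 * vmc_moment f k1 k2 k3.
Proof.
move=> law tf; rewrite div1r; set C := vmc_const _ _ _.
pose w x y := expR (k1 * cos x + k2 * cos y + k3 * cos (x - y)) : R.
have tw : torus_function w by exact: torus_vmc_weight.
pose W : {mfun T >-> RR} := HB.pack (fun t => (X t, Y t) : RR)
  (isMeasurableFun.Build _ _ _ _ _ mXY).
pose h (z : RR) := f (z.1 - mu1) (z.2 - mu2).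
pose p (z : RR) := vmc_density k1 k2 k3 mu1 mu2 z.1 z.2.
(* The angle [theta - mu1 - phi + mu2] is the difference of the two centred angles. *)
have pE z : p z = C^-1 * w (z.1 - mu1) (z.2 - mu2).
  by rewrite /p /vmc_density /w; congr (_ * expR (_ + _ * cos _)); ring.
have mh : measurable_fun setT h.
  by have [] := torus_bm (torus_shift mu1 mu2 tf).
have mp : measurable_fun setT p.
  have [+ _] := torus_bm (torusM (torus_cst C^-1) (torus_shift mu1 mu2 tw)).
  by apply: eq_measurable_fun => z _; rewrite pE.
rewrite meanE /Rintegral.
have -> : (\int[P]_t (f (X t - mu1) (Y t - mu2))%:E =
    \int[distribution P W]_z (h z)%:E)%E.
  rewrite integral_pushforward//; first exact/measurable_EFinP.
  rewrite preimage_setT; apply: bounded_measurable_integrable => //.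
    by rewrite ltey_eq fin_num_measure.
  exact: bounded_measurable_centred.
rewrite (@integral_density _ _ _ (lebesgue_measure \x lebesgue_measure)%E _
  (@square R) p (@measurable_square R) mp)//; last first.
- by move=> z; rewrite pE mulr_ge0 ?expR_ge0// invr_ge0 vmc_const_ge0.
have tfw := torusM tf tw.
transitivity (square_integral (fun x y => C^-1 * (f x y * w x y))); last first.
  exact: square_integralZ.
rewrite -(square_integral_shift (torusM (torus_cst C^-1) tfw) mu1pi mu2pi).
apply: eq_Rintegral => z _; rewrite pE /h /w; ring.
Qed.

End moments.

(** * Two independent copies of the pair of angles *)

Section iid.
Context d (T : measurableType d) (P : probability T R).
Variables (mu1 mu2 k1 k2 k3 : R) (X1 Y1 X2 Y2 : {RV P >-> R}).
Hypotheses (mu1pi : - pi <= mu1 <= pi) (mu2pi : - pi <= mu2 <= pi).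
Hypotheses (law1 : has_vmc_law k1 k2 k3 mu1 mu2 X1 Y1)
  (law2 : has_vmc_law k1 k2 k3 mu1 mu2 X2 Y2)
  (indep : independent_pairs X1 Y1 X2 Y2).
Let m f := 1 / vmc_const k1 k2 k3 * vmc_moment f k1 k2 k3.

Lemma mean_vmc_indep f g : torus_function f -> torus_function g ->
  mean P (fun t => f (X1 t - mu1) (Y1 t - mu2) * g (X2 t - mu1) (Y2 t - mu2)) =
  m f * m g.
Proof.
move=> tf tg; rewrite /m -(mean_vmc mu1pi mu2pi law1 tf).
rewrite -(mean_vmc mu1pi mu2pi law2 tg).
pose U t : RR := (X1 t, Y1 t); pose V t : RR := (X2 t, Y2 t).
have mU : measurable_fun setT U.
  exact: measurable_fun_pair (measurable_funPT X1) (measurable_funPT Y1).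
have mV : measurable_fun setT V.
  exact: measurable_fun_pair (measurable_funPT X2) (measurable_funPT Y2).
exact: (mean_indep mU mV indep (torus_bm (torus_shift mu1 mu2 tf))
  (torus_bm (torus_shift mu1 mu2 tg))).
Qed.

(** With [s], [c] the sine and cosine of one angle and [s'], [c'] those of the same or of the other
    angle, all three means in the Fisher-Lee coefficient are instances. *)
Lemma mean_sin_sub s c s' c' :
  torus_function s -> torus_function c ->
  torus_function s' -> torus_function c' ->
  (forall x y, s (- x) (- y) = - s x y) ->
  (forall x y, c' (- x) (- y) = c' x y) ->
  mean P (fun t =>
    (s (X1 t - mu1) (Y1 t - mu2) * c (X2 t - mu1) (Y2 t - mu2) -
     c (X1 t - mu1) (Y1 t - mu2) * s (X2 t - mu1) (Y2 t - mu2)) *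
    (s' (X1 t - mu1) (Y1 t - mu2) * c' (X2 t - mu1) (Y2 t - mu2) -
     c' (X1 t - mu1) (Y1 t - mu2) * s' (X2 t - mu1) (Y2 t - mu2))) =
  2 * (m (fun x y => s x y * s' x y) * m (fun x y => c x y * c' x y)).
Proof.
move=> ts tc ts' tc' sN c'N.
pose p f g t := f (X1 t - mu1) (Y1 t - mu2) * g (X2 t - mu1) (Y2 t - mu2).
have bp f g : torus_function f -> torus_function g ->
    bounded_measurable (p f g).
  by move=> tf tg; apply: bounded_measurableM; exact: bounded_measurable_centred.
have tM f g : torus_function f -> torus_function g ->
  torus_function (fun x y => f x y * g x y) by exact: torusM.
pose q f g x y := f x y * g x y : R.
(* The four products are regrouped by copy instead of by angle. *)
transitivity (mean P (fun t => (p (q s s') (q c c') t + p (q c c') (q s s') t) -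
    (p (q s c') (q c s') t + p (q c s') (q s c') t))).
  by congr mean; apply/funext => t; rewrite /p /q; ring.
rewrite meanB; last 2 first.
- by apply: bounded_measurableD; apply: bp; exact: tM.
- by apply: bounded_measurableD; apply: bp; exact: tM.
rewrite !meanD; try by apply: bp; exact: tM.
rewrite !mean_vmc_indep; try exact: tM.
(* The product [s * c'] is odd, and both cross terms contain its moment. *)
have -> : m (q s c') = 0.
  rewrite /m vmc_moment_odd ?mulr0//; first exact: tM.
  by move=> x y; rewrite /q sN c'N mulNr.
rewrite -/(q s s') -/(q c c'); ring.
Qed.

End iid.
End von_mises.

(** * Correlation coefficients and circular variances *)

Theorem theorem2p2 (R : realType) (mu1 mu2 k1 k2 k3 : R)
  (hmu1 : - pi <= mu1 < pi) (hmu2 : - pi <= mu2 < pi)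
  (hk1 : 0 <= k1) (hk2 : 0 <= k2)
  (d : measure_display) (T : measurableType d) (P : probability T R)
  (Theta Phi : {RV P >-> R})
  (hlaw : has_vmc_law k1 k2 k3 mu1 mu2 Theta Phi) :
  let C := vmc_const k1 k2 k3 in
  let C1 := pderiv1 (@vmc_const R) k1 k2 k3 in
  let C2 := pderiv2 (@vmc_const R) k1 k2 k3 in
  let C3 := pderiv3 (@vmc_const R) k1 k2 k3 in
  let C11 := pderiv11 (@vmc_const R) k1 k2 k3 in
  let C22 := pderiv22 (@vmc_const R) k1 k2 k3 in
  let C12 := pderiv12 (@vmc_const R) k1 k2 k3 in
  [/\ forall (d' : measure_display) (T' : measurableType d')
        (P' : probability T' R) (Theta1 Phi1 Theta2 Phi2 : {RV P' >-> R}),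
        iid_copies Theta Phi Theta1 Phi1 Theta2 Phi2 ->
        fisher_lee Theta1 Phi1 Theta2 Phi2 =
        ((1 / C * (C3 - C12)) * (1 / C * C12)) /
        Num.sqrt ((1 / C * C11) * (1 - 1 / C * C11) *
                  (1 / C * C22) * (1 - 1 / C * C22)),
      jammalamadaka_sarma mu1 mu2 Theta Phi =
        (1 / C * (C3 - C12)) /
        Num.sqrt ((1 - 1 / C * C11) * (1 - 1 / C * C22)),
      circular_variance mu1 Theta = 1 - 1 / C * C1 &
      circular_variance mu2 Phi = 1 - 1 / C * C2].
Proof.
move=> C C1 C2 C3 C11 C22 C12.
have mu1pi : - pi <= mu1 <= pi by case/andP: hmu1 => -> /ltW.
have mu2pi : - pi <= mu2 <= pi by case/andP: hmu2 => -> /ltW.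
(* The 2 in the numerator cancels against the root of [2 ^+ 2]; splitting the root uses the sign of
   that factor alone, so [a] and [b] are arbitrary. *)
have alg (s k a b : R) :
    2 * (s * k) / Num.sqrt (2 * ((1 - a) * a) * (2 * ((1 - b) * b))) =
    s * k / Num.sqrt (a * (1 - a) * b * (1 - b)).
  have -> : 2 * ((1 - a) * a) * (2 * ((1 - b) * b)) =
      2 ^+ 2 * (a * (1 - a) * b * (1 - b)) by ring.
  by rewrite sqrtrM ?sqr_ge0// sqrtr_sqr ger0_norm// -mulf_div divff ?mul1r.
have tcos1 := torus_cos1 R; have tsin1 := torus_sin1 R.
have tcos2 := torus_cos2 R; have tsin2 := torus_sin2 R.
have t1 : torus_function (fun _ _ => 1 : R) by exact: torus_cst.
pose m f := 1 / C * vmc_moment f k1 k2 k3.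
have meanE f : torus_function f ->
    mean P (fun t => f (Theta t - mu1) (Phi t - mu2)) = m f.
  exact: mean_vmc.
(* Each derivative becomes a moment once the normalizing constant is read as the moment of 1. *)
have C1E : 1 / C * C1 = m (fun x _ => cos x).
  rewrite /m /C1 vmc_constE pderiv1_vmc_moment//; congr (_ * _).
  by apply: eq_vmc_moment => x y; rewrite mul1r.
have C2E : 1 / C * C2 = m (fun _ y => cos y).
  rewrite /m /C2 vmc_constE pderiv2_vmc_moment//; congr (_ * _).
  by apply: eq_vmc_moment => x y; rewrite mul1r.
have C11E : 1 / C * C11 = m (fun x _ => cos x * cos x).
  rewrite /m /C11 /pderiv11 vmc_constE !pderiv1_vmc_moment//; last exact: torusM.
  by congr (_ * _); apply: eq_vmc_moment => x y; rewrite mul1r.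
have C22E : 1 / C * C22 = m (fun _ y => cos y * cos y).
  rewrite /m /C22 /pderiv22 vmc_constE !pderiv2_vmc_moment//; last exact: torusM.
  by congr (_ * _); apply: eq_vmc_moment => x y; rewrite mul1r.
have C12E : 1 / C * C12 = m (fun x y => cos x * cos y).
  rewrite /m /C12 /pderiv12 vmc_constE pderiv2_vmc_moment// pderiv1_vmc_moment//.
    by congr (_ * _); apply: eq_vmc_moment => x y; rewrite mul1r mulrC.
  exact: torusM.
have C3E : 1 / C * (C3 - C12) = m (fun x y => sin x * sin y).
  rewrite mulrBr C12E /C3 vmc_constE pderiv3_vmc_moment//.
  rewrite (@eq_vmc_moment _ _ (fun x y => cos x * cos y + sin x * sin y)).
    by rewrite vmc_momentD; [rewrite mulrDr addrAC subrr add0r|exact: torusM..].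
  by move=> x y; rewrite mul1r cosB.
(* Passing through [mean] lets the term 1 come from the total mass of [P]. *)
have S11E : m (fun x _ => sin x * sin x) =
    1 - m (fun x _ => cos x * cos x).
  rewrite -!meanE; [|exact: torusM..].
  rewrite -[X in X - _](mean_cst P) -meanB.
  - by congr mean; apply/funext => t; rewrite -!expr2 sin2cos2.
  - exact: bounded_measurable_cst.
  - exact: (bounded_measurable_centred mu1 mu2 Theta Phi (torusM tcos1 tcos1)).
have S22E : m (fun _ y => sin y * sin y) =
    1 - m (fun _ y => cos y * cos y).
  rewrite -!meanE; [|exact: torusM..].
  rewrite -[X in X - _](mean_cst P) -meanB.
  - by congr mean; apply/funext => t; rewrite -!expr2 sin2cos2.
  - exact: bounded_measurable_cst.
  - exact: (bounded_measurable_centred mu1 mu2 Theta Phi (torusM tcos2 tcos2)).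
(* Recorded before [m] becomes opaque, so that moments produced by [mean_sin_sub] are recognised
   afterwards. *)
have mE f : 1 / vmc_const k1 k2 k3 * vmc_moment f k1 k2 k3 = m f by [].
clearbody m C1 C2 C3 C11 C22 C12; clearbody C.
rewrite C1E C2E C3E C11E C22E C12E.
split.
- move=> d' T' P' X1 Y1 X2 Y2 [law1 law2 indep].
  have {}law1 : has_vmc_law k1 k2 k3 mu1 mu2 X1 Y1.
    by move=> A mA; rewrite law1// hlaw.
  have {}law2 : has_vmc_law k1 k2 k3 mu1 mu2 X2 Y2.
    by move=> A mA; rewrite law2// hlaw.
  (* The location [a] is inserted by writing [x - y] as [(x - a) - (y - a)]. *)
  have sinBE (x y a : R) : sin (x - y) =
      sin (x - a) * cos (y - a) - cos (x - a) * sin (y - a).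
    by rewrite -sinB; congr sin; ring.
  have mss := mean_sin_sub mu1pi mu2pi law1 law2 indep.
  rewrite /fisher_lee.
  under eq_fun do rewrite (sinBE _ _ mu1) (sinBE (Y1 _) _ mu2).
  under [X in Num.sqrt (mean _ X * _)]eq_fun do rewrite (sinBE _ _ mu1) expr2.
  under [X in Num.sqrt (_ * mean _ X)]eq_fun do rewrite (sinBE _ _ mu2) expr2.
  (* The numerator pairs the two angles; each denominator factor pairs an angle with itself. *)
  rewrite (mss _ _ _ _ tsin1 tcos1 tsin2 tcos2); last 2 first.
  - by move=> x y; rewrite sinN.
  - by move=> x y; rewrite cosN.
  rewrite (mss _ _ _ _ tsin1 tcos1 tsin1 tcos1); last 2 first.
  - by move=> x y; rewrite sinN.
  - by move=> x y; rewrite cosN.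
  rewrite (mss _ _ _ _ tsin2 tcos2 tsin2 tcos2); last 2 first.
  - by move=> x y; rewrite sinN.
  - by move=> x y; rewrite cosN.
  by rewrite !mE S11E S22E; exact: alg.
- rewrite /jammalamadaka_sarma.
  (* The right-hand side is read backwards, from cosine moments to sine moments and then to
     means. *)
  rewrite -S11E -S22E -!meanE; [|exact: torusM..].
  by congr (_ / Num.sqrt (mean _ _ * mean _ _)); apply/funext => t; rewrite expr2.
- by rewrite /circular_variance -meanE.
- by rewrite /circular_variance -meanE.
Qed.
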